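(* Let $(E,f,S)$ be an almost entropic partial Dowling geometry of rank $4$ which is closed under geometric products (every pair $s,s'\in S$ has a geometric product in $S$). Then $(S/\mathord{\sim},\cdot)$ is a group, where $\sim$ is the parallelism relation and $[s]\cdot[s']:=[t]$ for any geometric product $t$ of $s,s'$; moreover the inverse of $[s]$ is $[s^{-1}]$ for each $s\in S$.
   Context: A polymatroid is $(E,f)$ with $f:\mathcal{P}(E)\to\mathbb{R}$, $f(\emptyset)=0$, monotone, submodular (and of finite type, $f(S)=\sup_{F\subseteq S\text{ finite}}f(F)$, if $E$ is infinite); $f(a_1,\dots,a_k):=f(\{a_1,\dots,a_k\})$ and $\mathrm{cl}(A)=\{x\in E\mid f(A\cup\{x\})=f(A)\}$. A polymatroid is entropic if $f(S)=H((X_i)_{i\in S})$ for random variables $(X_i)_{i\in E}$ on a finite probability space (Shannon entropy), and almost entropic if it is of finite type and a pointwise limit of entropic polymatroids on $E$. A partial Dowling geometry (PDG) of rank $r$ is a triple $(E,f,S)$ where $(E,f)$ is a polymatroid and: (1) $S$ is a set with an involution $s\mapsto s^{-1}$ and a distinguished element $e$ with $e^{-1}=e$; (2) $E$ contains $B=\{b_1,\ldots,b_r\}$ with $f(A)=|A|$ for all $A\subseteq B$; (3) for each $1\le i<j\le r$, $E$ contains a copy $\{s_{i,j}\mid s\in S\}$ of $S$, these copies pairwise disjoint and disjoint from $B$, and $E=B\sqcup\bigsqcup_{i<j}\{s_{i,j}\mid s\in S\}$; one sets $s_{i,j}^{-1}:=(s^{-1})_{i,j}$, and for $i<j$, $s_{j,i}:=s_{i,j}^{-1}$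 and $s_{j,i}^{-1}:=s_{i,j}$; (4) $s_{i,j}\in\mathrm{cl}(b_i,b_j)$ for all distinct $i,j$; (5) $f(s_{i,j})=1$ and $f(b_i,s_{i,j})=2$ for all $s\in S$ and distinct $i,j$; (6) $f(s_{i,j},s^{-1}_{j,k},e_{k,i})=2$ for all $s\in S$ and distinct $i,j,k$. The PDG is almost entropic if $(E,f)$ is. A relator is a triple $(s,s',s'')\in S^3$ with $f(s_{i,j},s'_{j,k},s''_{k,i})=2$ for all pairwise distinct $i,j,k$; a geometric product of $s,s'$ is $t\in S$ such that $(s,s',t^{-1})$ is a relator. For $t,t'\in S$, $t\sim t'$ (parallelism) if $t'_{i,j}\in\mathrm{cl}(t_{i,j})$ for some (equivalently, in this setting, all) distinct $1\le i,j\le4$; $[t]$ is the equivalence class of $t$. *)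

(* Defs.v *)
From mathcomp Require Import all_boot all_order all_algebra.
From mathcomp Require Import all_classical all_reals all_analysis.

Set Implicit Arguments.
Unset Strict Implicit.
Unset Printing Implicit Defensive.

Import Order.TTheory GRing.Theory Num.Theory.
Import numFieldNormedType.Exports.

Local Open Scope classical_set_scope.
Local Open Scope ring_scope.

Section Polymatroids.
Variables (R : realType) (E : Type).
Implicit Types (f : set E -> R) (A B : set E).

Definition finite_type f :=
  forall A, f A = sup [set f F | F in [set F | F `<=` A /\ finite_set F]].

Record polymatroid f : Prop := Polymatroid {
  polymatroid0 : f set0 = 0;
  polymatroid_monotone : forall A B, A `<=` B -> f A <= f B;
  polymatroid_submodular :
    forall A B, f (A `|` B) + f (A `&` B) <= f A + f B;
  polymatroid_finite_type : infinite_set [set: E] -> finite_type f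
}.

Definition cl f A : set E := [set x | f (A `|` [set x]) = f A].

End Polymatroids.

Section Entropy.
Variable R : realType.

Definition is_pmf (Omega : finType) (p : Omega -> R) :=
  (forall w, 0 <= p w) /\ \sum_w p w = 1.

Definition law (Omega : finType) (p : Omega -> R) (T : eqType) (X : Omega -> T)
    (x : T) : R :=
  \sum_(w | X w == x) p w.

(* Natural logarithm; [ln 0 = 0], so null values contribute [0]. *)
Definition entropy (Omega : finType) (p : Omega -> R) (T : eqType)
    (X : Omega -> T) : R :=
  - \sum_(x <- undup (codom X)) law p X x * ln (law p X x).

(* The joint variable (X_i)_{i in A}; A may be infinite. Its codomain is a
   product type, whose eqType structure is the classical one. *)
Definition joint (Omega E : Type) (V : E -> eqType) (X : forall i, Omega -> V i)
    (A : set E) (w : Omega) : forall i : {i : E | A i}, V (sval i) :=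
  fun i => X (sval i) w.

Arguments joint {Omega E V} X A w i.

Definition entropic (E : Type) (f : set E -> R) :=
  polymatroid f /\
  exists (Omega : finType) (p : Omega -> R) (V : E -> eqType)
         (X : forall i, Omega -> V i),
    is_pmf p /\ forall A : set E, f A = entropy p (joint X A).

Definition almost_entropic (E : Type) (f : set E -> R) :=
  finite_type f /\
  exists g : nat -> set E -> R,
    (forall n, entropic (g n)) /\
    (forall A : set E, (fun n => g n A) @ \oo --> f A).

End Entropy.

(* The element s_{i,j} for arbitrary distinct i, j, given the copies [c s i j]
   of S for i < j: s_{j,i} is (s^{-1})_{i,j}. With this convention the element
   written s_{i,j}^{-1} is (s^{-1})_{i,j} for i > j as well. *)
Definition signed_copy (r : nat) (S E : Type) (inv : S -> S)
    (c : S -> 'I_r -> 'I_r -> E) (s : S) (i j : 'I_r) : E :=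
  if (i < j)%N then c s i j else c (inv s) j i.

(* [pdg_copy s i j] is meaningful for i < j only; its other values are
   unconstrained and never used. *)
Record pdg (R : realType) (r : nat) := PDG {
  pdg_E : Type;
  pdg_f : set pdg_E -> R;
  pdg_S : Type;
  pdg_inv : pdg_S -> pdg_S;
  pdg_e : pdg_S;
  pdg_b : 'I_r -> pdg_E;
  pdg_copy : pdg_S -> 'I_r -> 'I_r -> pdg_E;
  pdg_elt := signed_copy pdg_inv pdg_copy;
  pdg_polymatroid : polymatroid pdg_f;
  pdg_invK : involutive pdg_inv;
  pdg_inv_e : pdg_inv pdg_e = pdg_e;
  pdg_b_inj : injective pdg_b;
  pdg_f_b : forall J : {set 'I_r}, pdg_f (pdg_b @` [set` J]) = #|J|%:R;
  pdg_copy_inj : forall s t (i j k l : 'I_r), (i < j)%N -> (k < l)%N ->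
    pdg_copy s i j = pdg_copy t k l -> [/\ s = t, i = k & j = l];
  pdg_copy_b : forall s (i j k : 'I_r), (i < j)%N ->
    pdg_copy s i j <> pdg_b k;
  pdg_cover : forall x, (exists i, x = pdg_b i) \/
    (exists s (i j : 'I_r), (i < j)%N /\ x = pdg_copy s i j);
  pdg_elt_cl : forall s (i j : 'I_r), i != j ->
    cl pdg_f [set pdg_b i; pdg_b j] (pdg_elt s i j);
  pdg_f_elt : forall s (i j : 'I_r), i != j ->
    pdg_f [set pdg_elt s i j] = 1;
  pdg_f_b_elt : forall s (i j : 'I_r), i != j ->
    pdg_f [set pdg_b i; pdg_elt s i j] = 2;
  pdg_f_triangle : forall s (i j k : 'I_r), i != j -> j != k -> k != i ->
    pdg_f [set pdg_elt s i j; pdg_elt (pdg_inv s) j k; pdg_elt pdg_e k i] = 2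
}.

Section GeometricProducts.
Variables (R : realType) (r : nat) (G : pdg R r).
Implicit Types s t : pdg_S G.

Definition relator s s' s'' :=
  forall i j k : 'I_r, i != j -> j != k -> k != i ->
    pdg_f [set pdg_elt s i j; pdg_elt s' j k; pdg_elt s'' k i] = 2.

Definition geometric_product s s' t := relator s s' (pdg_inv t).

Definition closed_under_products :=
  forall s s', exists t, geometric_product s s' t.

Definition parallel t t' :=
  exists i j : 'I_r, i != j /\
    cl (@pdg_f R r G) [set pdg_elt t i j] (pdg_elt t' i j).

Definition parallel_class t : set (pdg_S G) := [set t' | parallel t t'].

Definition parallel_quot :=
  {c : set (pdg_S G) | exists t, c = parallel_class t}.

Definition quot_class t : parallel_quot :=
  exist _ (parallel_class t) (ex_intro _ t erefl).

End GeometricProducts.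

Record is_group (Q : Type) (mul : Q -> Q -> Q) (one : Q) (inv : Q -> Q) :
    Prop := IsGroup {
  is_group_mulA : associative mul;
  is_group_mul1 : left_id one mul;
  is_group_mulr1 : right_id one mul;
  is_group_mulV : left_inverse one inv mul;
  is_group_mulrV : right_inverse one inv mul
}.

(* Main.v *)
Require Import Defs.
From mathcomp Require Import all_boot all_order all_algebra.
From mathcomp Require Import all_classical all_reals all_analysis.
From mathcomp Require Import lra.

(** All uniqueness statements come from one modularity argument: two rank-one
    points lying both in the closure of [A] and on the line [cl(b_i, b_k)] are
    parallel as soon as [f(A, b_i, b_k) >= f(A) + 1].  With [A] the line spanned
    by [s_{i,j}] and [s'_{j,k}] this makes the product well defined on classes;
    with [A] the plane spanned by [s_{1,2}], [s'_{2,3}], [s''_{3,4}], which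
    contains both iterated products at [(1,4)], it gives associativity, and this
    is where rank 4 is needed.  The triangle axiom supplies the unit, the
    inverses, and the transport of parallelism between pairs of indices. *)

Set Implicit Arguments.
Unset Strict Implicit.
Unset Printing Implicit Defensive.

Import Order.TTheory GRing.Theory Num.Theory.
Local Open Scope classical_set_scope.
Local Open Scope ring_scope.

Ltac set_incl := let z := fresh "z" in move=> z; rewrite /setU /=; tauto.

(** * Closure in a polymatroid and the modularity argument *)

Section PolymatroidClosure.
Variables (R : realType) (E : Type) (f : set E -> R).
Hypothesis fP : polymatroid f.
Implicit Types (A B : set E) (x y : E).

Let f_mono A B : A `<=` B -> f A <= f B.
Proof. exact: polymatroid_monotone. Qed.

Lemma cl_le A x : f (A `|` [set x]) <= f A -> cl f A x.
Proof.
move=> le; apply/eqP; rewrite eq_le le /=.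
by apply: f_mono; set_incl.
Qed.

Lemma cl_mem A x : A x -> cl f A x.
Proof. by move=> Ax; apply: cl_le; apply: f_mono => z [|->]. Qed.

(** Submodularity for [B] and [A] with [x] added: the union is [B] with [x], and the intersection
    still contains [A], so [x] adds no more to [B] than to [A]. *)
Lemma cl_sub A B x : A `<=` B -> cl f A x -> cl f B x.
Proof.
move=> AB clx; apply: cl_le.
have := polymatroid_submodular fP B (A `|` [set x]).
have -> : B `|` (A `|` [set x]) = B `|` [set x].
  by apply/seteqP; split=> z; rewrite /setU /=; have := AB z; tauto.
have : f A <= f (B `&` (A `|` [set x])).
  by apply: f_mono => z Az; split; [exact: AB|left].
by move: clx; rewrite /cl /= => ->; lra.
Qed.

Lemma cl_trans A x y : cl f A y -> cl f (A `|` [set y]) x -> cl f A x.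
Proof.
rewrite /cl /= => cly clx; apply: cl_le; rewrite -cly -clx.
by apply: f_mono; set_incl.
Qed.

Lemma cl_pair A x y : cl f A x -> cl f A y -> f (A `|` [set x; y]) = f A.
Proof.
move=> clx /(@cl_sub _ (A `|` [set x])) cly; rewrite setUA.
by rewrite cly ?clx //; set_incl.
Qed.

Lemma cl_trans2 A x y z :
  cl f A x -> cl f A y -> cl f [set x; y] z -> cl f A z.
Proof.
move=> clx cly clz; apply: (cl_trans clx).
apply: (@cl_trans _ _ y); first by apply: (cl_sub _ cly); set_incl.
by apply: (cl_sub _ clz); set_incl.
Qed.

(** Adding [x] and [y] changes neither [f A] nor [f B], but puts both points into the intersection,
    where submodularity counts them. *)
Lemma cl_meet A B x y : cl f A x -> cl f A y -> cl f B x -> cl f B y ->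
  f [set x; y] + f (A `|` B) <= f A + f B.
Proof.
move=> Ax Ay Bx By; rewrite -(cl_pair Ax Ay) -(cl_pair Bx By).
have := polymatroid_submodular fP (A `|` [set x; y]) (B `|` [set x; y]).
suff [H1 H2] : f [set x; y] <= f ((A `|` [set x; y]) `&` (B `|` [set x; y]))
  /\ f (A `|` B) <= f ((A `|` [set x; y]) `|` (B `|` [set x; y])) by lra.
by split; apply: f_mono; rewrite /setI; set_incl.
Qed.

(** The inequality leaves the meet of the two closures no more rank than [x] alone has, so [y] adds
    nothing to [x]. *)
Lemma cl_modular A B x y : cl f A x -> cl f A y -> cl f B x -> cl f B y ->
  f A + f B <= f (A `|` B) + f [set x] -> cl f [set x] y.
Proof.
move=> Ax Ay Bx By le; apply: cl_le.
by have := cl_meet Ax Ay Bx By; lra.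
Qed.

Lemma f_add1 A x : f (A `|` [set x]) <= f A + f [set x].
Proof.
have := polymatroid_submodular fP A [set x].
have := f_mono (@sub0set _ (A `&` [set x])).
by rewrite (polymatroid0 fP); lra.
Qed.

End PolymatroidClosure.

(** * Ranks of points and lines in a partial Dowling geometry *)

Section PartialDowlingGeometry.
Variables (R : realType) (r : nat) (G : pdg R r).
Implicit Types (s t : pdg_S G) (i j k l : 'I_r).

Let f := @pdg_f R r G.
Let fP : polymatroid f := pdg_polymatroid G.
Let b := @pdg_b R r G.
Let elt := @pdg_elt R r G.

Lemma elt_inv s i j : i != j -> elt (pdg_inv s) j i = elt s i j.
Proof.
rewrite /elt /pdg_elt /signed_copy -val_eqE /= => ij.
by case: ltngtP ij => // _ _; rewrite pdg_invK.
Qed.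

Lemma f_elt s i j : i != j -> f [set elt s i j] = 1.
Proof. exact: pdg_f_elt. Qed.

Lemma elt_cl s i j : i != j -> cl f [set b i; b j] (elt s i j).
Proof. exact: pdg_elt_cl. Qed.

Lemma f_b2 i j : i != j -> f [set b i; b j] = 2.
Proof.
move=> ij; have := @pdg_f_b _ _ G [set i; j]%SET.
rewrite cards2 ij /= => <-; congr (@pdg_f _ _ G _).
apply/seteqP; split=> z /=.
  by case=> ->; [exists i|exists j] => //=; rewrite !inE eqxx ?orbT.
by case=> k; rewrite /= !inE => /orP[]/eqP-> <-; [left|right].
Qed.

Lemma f_b3 i j k : i != j -> j != k -> k != i -> f [set b i; b j; b k] = 3.
Proof.
move=> ij jk ki; have := @pdg_f_b _ _ G [set i; j; k]%SET.
have -> : #|[set i; j; k]%SET| = 3%N.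
  by rewrite finset.setUC cardsU1 cards2 !inE ij negb_or ki eq_sym jk.
move=> <-; congr (@pdg_f _ _ G _); apply/seteqP; split=> z /=.
  by case=> [[]|] ->; [exists i|exists j|exists k] => //=;
    rewrite !inE eqxx ?orbT.
by case=> l; rewrite /= !inE => /orP[/orP[]|]/eqP-> <-; tauto.
Qed.

Lemma f_b4 i j k l : uniq [:: i; j; k; l] -> f [set b i; b j; b k; b l] = 4.
Proof.
move=> u; have := @pdg_f_b _ _ G [set x in [:: i; j; k; l]]%SET.
rewrite cardsE (card_uniqP u) /= => <-; congr (@pdg_f _ _ G _).
apply/seteqP; split=> z /=.
  by case=> [[[]|]|] ->; [exists i|exists j|exists k|exists l] => //=;
    rewrite !inE eqxx ?orbT.
by case=> m; rewrite /= !inE => /or4P[]/eqP-> <-; tauto.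
Qed.

(** Exchange on a line: [b i] and the point already have rank 2, the rank of the whole line through
    [b i] and [b j]. *)
Lemma b_cl s i j : i != j -> cl f [set b i; elt s i j] (b j).
Proof.
move=> ij; rewrite /cl /=.
have -> : [set b i; elt s i j] `|` [set b j] = [set b i; b j; elt s i j].
  by apply/seteqP; split; set_incl.
by rewrite (elt_cl s ij) (f_b2 ij); symmetry; apply: pdg_f_b_elt.
Qed.

Lemma f_line_ge s s' i j k : i != j -> j != k -> k != i ->
  3 <= f ([set elt s i j; elt s' j k] `|` [set b i; b k]).
Proof.
move=> ij jk ki; set A := _ `|` _; rewrite -(f_b3 ij jk ki).
have <- : f (A `|` [set b j]) = f A.
  by apply: (cl_sub fP _ (b_cl s ij)); rewrite /A; set_incl.
by apply: (polymatroid_monotone fP); rewrite /A; set_incl.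
Qed.

(** Subadditivity gives the upper bound. For the lower one, adding [b i] costs at most 1 and yields
    a set of rank at least 3. *)
Lemma f_line s s' i j k : i != j -> j != k -> k != i ->
  f [set elt s i j; elt s' j k] = 2.
Proof.
move=> ij jk ki; apply/eqP; rewrite eq_le; apply/andP; split.
  have := f_add1 fP [set elt s i j] (elt s' j k).
  by rewrite !f_elt //; lra.
have fbi : f [set b i] = 1.
  rewrite -[RHS]/(1%:R) -(cards1 i) -(@pdg_f_b _ _ G).
  congr (@pdg_f _ _ G _); apply/seteqP; split=> z /=.
    by move=> ->; exists i => //=; rewrite inE.
  by case=> m; rewrite /= !inE => /eqP-> <-.
have := f_line_ge s s' ij jk ki; set A := [set _; _].
have := f_add1 fP A (b i); rewrite fbi.
have -> : A `|` [set b i; b k] = (A `|` [set b i]) `|` [set b k].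
  by rewrite setUA.
(* Once [b i] is present, the first point yields [b j], and then the second yields [b k]. *)
suff -> : f ((A `|` [set b i]) `|` [set b k]) = f (A `|` [set b i]) by lra.
apply: (cl_trans fP (y := b j)).
  by apply: (cl_sub fP _ (b_cl s ij)); rewrite /A; set_incl.
by apply: (cl_sub fP _ (b_cl s' jk)); rewrite /A; set_incl.
Qed.

(** The third point of the relator, the inverse of [t] at [(k,i)], is [t] at [(i,k)]; it does not
    raise the rank 2 of the first two. *)
Lemma geometric_product_cl s s' t i j k : i != j -> j != k -> k != i ->
  geometric_product s s' t -> cl f [set elt s i j; elt s' j k] (elt t i k).
Proof.
move=> ij jk ki /(_ i j k ij jk ki) H; rewrite /cl /= f_line //.
by rewrite -[elt t i k]elt_inv // eq_sym.
Qed.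

(** * Unit and inverses, as cyclic rotations of the triangle axiom *)

Lemma geometric_product1 s : geometric_product (pdg_e G) s s.
Proof.
move=> i j k ij jk ki; rewrite -(pdg_f_triangle s jk ki ij).
by congr (@pdg_f _ _ G _); apply/seteqP; split; set_incl.
Qed.

Lemma geometric_productr1 s : geometric_product s (pdg_e G) s.
Proof.
move=> i j k ij jk ki; rewrite -(pdg_f_triangle (pdg_inv s) ki ij jk) pdg_invK.
by congr (@pdg_f _ _ G _); apply/seteqP; split; set_incl.
Qed.

Lemma geometric_productrV s : geometric_product s (pdg_inv s) (pdg_e G).
Proof. by move=> i j k ij jk ki; rewrite pdg_inv_e; apply: pdg_f_triangle. Qed.

Lemma geometric_productV s : geometric_product (pdg_inv s) s (pdg_e G).
Proof. by rewrite -{2}(pdg_invK s); apply: geometric_productrV. Qed.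

(** * Parallelism at a fixed pair of indices and its behaviour under products *)

Definition parallel_at i j s t := cl f [set elt s i j] (elt t i j).

Lemma parallel_at_refl i j s : parallel_at i j s s.
Proof. exact: cl_mem. Qed.

Lemma parallel_at_sym i j s t : i != j ->
  parallel_at i j s t -> parallel_at i j t s.
Proof. by move=> ij; rewrite /parallel_at /cl /= setUC !f_elt. Qed.

Lemma parallel_at_trans i j s t u :
  parallel_at i j s t -> parallel_at i j t u -> parallel_at i j s u.
Proof.
move=> st tu; apply: (cl_trans fP st).
by apply: (cl_sub fP _ tu); set_incl.
Qed.

Lemma parallel_at_inv i j s t : i != j ->
  parallel_at i j s t -> parallel_at j i (pdg_inv s) (pdg_inv t).
Proof. by move=> ij; rewrite /parallel_at !elt_inv. Qed.

(** Two lines of rank 2 with a union of rank at least 3 meet in rank at most 1. *)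
Lemma line_parallel s s' t t' i j k : i != j -> j != k -> k != i ->
  cl f [set elt s i j; elt s' j k] (elt t i k) ->
  cl f [set elt s i j; elt s' j k] (elt t' i k) -> parallel_at i k t t'.
Proof.
move=> ij jk ki ct ct'; have ik : i != k by rewrite eq_sym.
apply: (cl_modular fP ct ct' (elt_cl t ik) (elt_cl t' ik)).
rewrite f_line // f_b2 // f_elt //.
by have := f_line_ge s s' ij jk ki; lra.
Qed.

Lemma geometric_product_parallel_at s s' t s1 s1' t1 i j k :
  i != j -> j != k -> k != i ->
  geometric_product s s' t -> geometric_product s1 s1' t1 ->
  parallel_at i j s s1 -> parallel_at j k s' s1' -> parallel_at i k t t1.
Proof.
move=> ij jk ki p p1 ss1 ss1'; apply: (line_parallel (s := s) (s' := s') ij jk ki).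
  exact: geometric_product_cl p.
apply: (cl_trans2 fP _ _ (geometric_product_cl ij jk ki p1)).
  by apply: (cl_sub fP _ ss1); set_incl.
by apply: (cl_sub fP _ ss1'); set_incl.
Qed.

(** Multiplying on the right by the unit at [(j,k)] carries [s] and [t] from [(i,j)] to [(i,k)]. *)
Lemma parallel_at_right i j k s t : i != j -> i != k ->
  parallel_at i j s t -> parallel_at i k s t.
Proof.
have [-> //|jk] := eqVneq j k; move=> ij; rewrite eq_sym => ki st.
exact: (geometric_product_parallel_at ij jk ki (geometric_productr1 s)
  (geometric_productr1 t) st (parallel_at_refl _ _ _)).
Qed.

Lemma parallel_at_left i j k s t : i != j -> k != j ->
  parallel_at i j s t -> parallel_at k j s t.
Proof.
have [-> //|ki] := eqVneq k i; move=> ij; rewrite eq_sym => jk st.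
exact: (geometric_product_parallel_at ki ij jk (geometric_product1 s)
  (geometric_product1 t) (parallel_at_refl _ _ _) st).
Qed.

(** The plane has rank at most 3 and the line through [b i] and [b l] rank 2; jointly they span four
    independent joints, so they meet in rank at most 1. *)
Lemma plane_parallel s s' s'' t t' i j k l : uniq [:: i; j; k; l] ->
  cl f [set elt s i j; elt s' j k; elt s'' k l] (elt t i l) ->
  cl f [set elt s i j; elt s' j k; elt s'' k l] (elt t' i l) ->
  parallel_at i l t t'.
Proof.
move=> u ct ct'; have := u; rewrite /= !inE !negb_or.
move=> /and4P[/and3P[ij ik il] /andP[jk jl] kl _].
apply: (cl_modular fP ct ct' (elt_cl t il) (elt_cl t' il)).
rewrite f_b2 // f_elt //.
have ki : k != i by rewrite eq_sym.
have := f_add1 fP [set elt s i j; elt s' j k] (elt s'' k l).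
rewrite f_line // f_elt //; set A := [set elt _ _ _; _; _].
suff : 4 <= f (A `|` [set b i; b l]) by lra.
rewrite -(f_b4 u).
(* Starting from [b i], the points of the plane yield [b j] and then [b k]. *)
have cj : cl f (A `|` [set b i; b l]) (b j).
  by apply: (cl_sub fP _ (b_cl s ij)); rewrite /A; set_incl.
have ck : cl f (A `|` [set b i; b l]) (b k).
  apply: (cl_trans fP cj).
  by apply: (cl_sub fP _ (b_cl s' jk)); rewrite /A; set_incl.
rewrite -(cl_pair fP cj ck).
by apply: (polymatroid_monotone fP); rewrite /A; set_incl.
Qed.

(** The partial products [t] at [(i,k)] and [v] at [(j,l)] lie in the plane of the three factors,
    hence so do [u] and [w] at [(i,l)]. *)
Lemma geometric_productA s s' s'' t u v w i j k l : uniq [:: i; j; k; l] ->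
  geometric_product s s' t -> geometric_product t s'' u ->
  geometric_product s' s'' v -> geometric_product s v w ->
  parallel_at i l u w.
Proof.
move=> un pt pu pv pw; have := un; rewrite /= !inE !negb_or.
move=> /and4P[/and3P[ij ik il] /andP[jk jl] kl _].
have [ki li lj] : [/\ k != i, l != i & l != j] by split; rewrite eq_sym.
apply: (plane_parallel (s := s) (s' := s') (s'' := s'') un).
  apply: (cl_trans2 fP _ _ (geometric_product_cl ik kl li pu)).
    by apply: (cl_sub fP _ (geometric_product_cl ij jk ki pt)); set_incl.
  by apply: cl_mem => //; right.
apply: (cl_trans2 fP _ _ (geometric_product_cl ij jl li pw)).
  by apply: cl_mem => //; do 2 left.
by apply: (cl_sub fP _ (geometric_product_cl jk kl lj pv)); set_incl.
Qed.

(** * Independence of parallelism from the pair of indices *)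

Hypothesis r_gt2 : (2 < r)%N.

Lemma parallel_at_change i j k l s t : i != j -> k != l ->
  parallel_at i j s t -> parallel_at k l s t.
Proof.
move=> ij kl st.
(* The route is [(i,j)], [(m,j)], [(m,l)], [(k,l)]; [m] may equal [i] or [k] and only has to avoid
   [j] and [l]. *)
have [m] : exists m, m \in ~: [set j; l]%SET.
  apply/set0Pn; rewrite -card_gt0 cardsCs finset.setCK card_ord subn_gt0.
  by rewrite (leq_ltn_trans _ r_gt2) // cards2; case: (_ != _).
rewrite !inE negb_or => /andP[mj ml].
exact/(parallel_at_left ml kl)/(parallel_at_right mj ml)/(parallel_at_left ij mj).
Qed.

Lemma parallelP i j s t : i != j -> parallel s t <-> parallel_at i j s t.
Proof.
move=> ij; split; last by exists i, j.
by case=> k [l [kl]]; apply: parallel_at_change.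
Qed.

End PartialDowlingGeometry.

(** * The group of parallelism classes *)

Section Quotient.
Variables (R : realType) (G : pdg R 4).
Hypothesis G_closed : closed_under_products G.
Implicit Types (s t : pdg_S G) (c d : parallel_quot G).

Let i0 : 'I_4 := inord 0.
Let i1 : 'I_4 := inord 1.
Let i2 : 'I_4 := inord 2.
Let i3 : 'I_4 := inord 3.

Let lt24 : (2 < 4)%N := isT.

Let uniq_idx : uniq [:: i0; i1; i2; i3].
Proof. by rewrite /= !inE -!val_eqE /= !inordK. Qed.

Let i01 : i0 != i1. Proof. by rewrite -val_eqE /= !inordK. Qed.
Let i12 : i1 != i2. Proof. by rewrite -val_eqE /= !inordK. Qed.
Let i20 : i2 != i0. Proof. by rewrite -val_eqE /= !inordK. Qed.
Let i02 : i0 != i2. Proof. by rewrite -val_eqE /= !inordK. Qed.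
Let i03 : i0 != i3. Proof. by rewrite -val_eqE /= !inordK. Qed.

Lemma parallel_equivalence : RelationClasses.Equivalence (@parallel R 4 G).
Proof.
split=> [s|s t|s t u].
- by apply/(parallelP lt24 _ _ i01); apply: parallel_at_refl.
- by move=> /(parallelP lt24 _ _ i01) /(parallel_at_sym i01) st;
    exists i0, i1.
- move=> /(parallelP lt24 _ _ i01) st.
  move=> /(parallelP lt24 _ _ i01) tu.
  by exists i0, i1; split=> //; apply: parallel_at_trans st tu.
Qed.

Lemma quot_classP s t : quot_class s = quot_class t <-> parallel s t.
Proof.
have [refl sym trans] := parallel_equivalence; split=> [[E]|st].
  by have : parallel_class t t := refl t; rewrite -E.
apply: eq_exist; apply/seteqP; split=> u /= h.
  by apply: trans h; apply: sym.
exact: trans h.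
Qed.

Lemma quot_class_surj c : exists s, quot_class s = c.
Proof. by case: c => c [s Es]; exists s; apply: eq_exist. Qed.

Lemma geometric_product_parallel s s' t s1 s1' t1 :
  geometric_product s s' t -> geometric_product s1 s1' t1 ->
  parallel s s1 -> parallel s' s1' -> parallel t t1.
Proof.
move=> p p1 /(parallelP lt24 _ _ i01) a /(parallelP lt24 _ _ i12) a'.
exists i0, i2; split=> //.
exact: (geometric_product_parallel_at i01 i12 i20 p p1 a a').
Qed.

(** Representatives and products are picked by choice; [quot_mulE] and [quot_invE] show that the
    operations on classes do not depend on it. *)
Definition rep c : pdg_S G := sval (cid (quot_class_surj c)).
Definition gprod s s' : pdg_S G := sval (cid (G_closed s s')).
Definition quot_mul c d : parallel_quot G := quot_class (gprod (rep c) (rep d)).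
Definition quot_inv c : parallel_quot G := quot_class (pdg_inv (rep c)).

Lemma repK c : quot_class (rep c) = c.
Proof. exact: (svalP (cid (quot_class_surj c))). Qed.

Lemma gprodP s s' : geometric_product s s' (gprod s s').
Proof. exact: (svalP (cid (G_closed s s'))). Qed.

Lemma quot_mulE s s' t : geometric_product s s' t ->
  quot_mul (quot_class s) (quot_class s') = quot_class t.
Proof.
move=> p; apply/quot_classP; apply: (geometric_product_parallel (gprodP _ _) p);
  by apply/quot_classP; rewrite repK.
Qed.

Lemma quot_invE s : quot_inv (quot_class s) = quot_class (pdg_inv s).
Proof.
(* The pair is reversed because an inverse at [(i1,i0)] is the original element at [(i0,i1)]. *)
apply/quot_classP; exists i1, i0; split; first by rewrite eq_sym.
apply: parallel_at_inv => //; apply/(parallelP lt24 _ _ i01).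
by apply/quot_classP; rewrite repK.
Qed.

Lemma quot_is_group : is_group quot_mul (quot_class (pdg_e G)) quot_inv.
Proof.
have QE c : exists s, c = quot_class s by have [s] := quot_class_surj c; exists s.
split.
- move=> c1 c2 c3.
  have [[s1 ->] [[s2 ->] [s3 ->]]] := (QE c1, (QE c2, QE c3)).
  rewrite (quot_mulE (gprodP s1 s2)) (quot_mulE (gprodP s2 s3)).
  rewrite (quot_mulE (gprodP _ _)) (quot_mulE (gprodP _ _)).
  (* The iterated products are compared at the two ends of the chain of four indices; parallelism at
     this one pair suffices. *)
  apply/esym/quot_classP; exists i0, i3; split=> //.
  by apply: (geometric_productA uniq_idx); apply: gprodP.
- by move=> c; have [s ->] := QE c; apply/quot_mulE/geometric_product1.
- by move=> c; have [s ->] := QE c; apply/quot_mulE/geometric_productr1.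
- move=> c; have [s ->] := QE c; rewrite quot_invE.
  exact/quot_mulE/geometric_productV.
- move=> c; have [s ->] := QE c; rewrite quot_invE.
  exact/quot_mulE/geometric_productrV.
Qed.

End Quotient.

Theorem theorem5p9 (R : realType) (G : pdg R 4)
    (G_almost_entropic : almost_entropic (@pdg_f R 4 G))
    (G_closed : closed_under_products G) :
  RelationClasses.Equivalence (@parallel R 4 G) /\
  exists (mul : parallel_quot G -> parallel_quot G -> parallel_quot G)
         (one : parallel_quot G) (inv : parallel_quot G -> parallel_quot G),
    is_group mul one inv /\
    (forall s s' t : pdg_S G, geometric_product s s' t ->
       mul (quot_class s) (quot_class s') = quot_class t) /\
    (forall s : pdg_S G, inv (quot_class s) = quot_class (pdg_inv s)).
Proof.
split; first exact: parallel_equivalence.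
exists (quot_mul G_closed), (quot_class (pdg_e G)), (@quot_inv R G).
split; first exact: quot_is_group.
by split; [exact: quot_mulE|exact: quot_invE].
Qed.
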